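(* Given any $\mu\in[\mu_0,\delta^{-1}]$, if $$\lim_{(\varsigma,\sigma)\to\partial\mathcal S_\mu^+}P_\mu^d(\varsigma,\sigma)=-\infty,\qquad \forall(\varsigma,\sigma)\in\mathcal S_\mu^+,$$ and $$\lim_{\varsigma\to\infty,\ \sigma\to-\infty}P_\mu^d(\varsigma,\sigma)=-\infty,\qquad \forall(\varsigma,\sigma)\in\mathcal S_\mu^+,$$ then the canonical dual problem $$(\mathcal P_\mu^d)\qquad \sup\ P_\mu^d(\varsigma,\sigma)\quad\text{s.t.}\quad(\varsigma,\sigma)\in\mathcal S_\mu^+$$ has at least one global optimal solution $(\varsigma_\mu,\sigma_\mu)\in\mathcal S_\mu^+$.
   Context: Data: $B\in\mathbb R^{m\times n}$; $Q\in\mathbb R^{n\times n}$ symmetric; $H\in\mathbb R^{n\times n}$ negative definite; $\lambda\in\mathbb R^+$; $f,b\in\mathbb R^n$. Define $h(x)=\tfrac12x^THx-b^Tx$ for $x\in\mathbb R^n$. Assume $h(H^{-1}b)>0$, define $\mu_0$ by $\mu_0^{-1}=h(H^{-1}b)$, and fix $\delta\in(0,\mu_0^{-1}]$. For $\mu\in[\mu_0,\delta^{-1}]$ let $$G_\mu(\varsigma,\sigma)=Q+\mu\varsigma B^TB-\sigma H\quad\text{for }\varsigma\ge-\lambda,\ \sigma\ge0,$$ $$\mathcal S_\mu^+=\{(\varsigma,\sigma):\varsigma\ge-\lambda,\ \sigma\ge0,\ G_\mu(\varsigma,\sigma)\succ0\},$$ $$\partial\mathcal S_\mu^+=\{(\varsigma,\sigma):\varsigma\ge-\lambda,\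 \sigma\ge0,\ G_\mu(\varsigma,\sigma)\succeq0,\ \det G_\mu(\varsigma,\sigma)=0\},$$ where $\succ0$ and $\succeq0$ mean positive definite and positive semidefinite. The dual objective is $$P_\mu^d(\varsigma,\sigma)=-\tfrac12(f-\sigma b)^TG_\mu(\varsigma,\sigma)^{-1}(f-\sigma b)-\mu\lambda\varsigma-\tfrac{\mu}{2}\varsigma^2+\tfrac{\sigma}{\mu}.$$ In both limits, $(\varsigma,\sigma)$ ranges over $\mathcal S_\mu^+$.
   Formalization: The printed second limit (σ→−∞) is vacuous since σ≥0, and the claim then fails at μ=μ₀; it is replaced by P→−∞ on S⁺ whenever ς→+∞ or σ→+∞ (at least one), which is automatic for μ>μ₀. *)

(* Defs.v *)
From HB Require Import structures.
From mathcomp Require Import all_boot all_order all_algebra.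
From mathcomp Require Import all_classical all_reals all_analysis.
Set Implicit Arguments.
Unset Strict Implicit.
Unset Printing Implicit Defensive.
Import Order.TTheory GRing.Theory Num.Theory.
Import numFieldNormedType.Exports.
Local Open Scope classical_set_scope.
Local Open Scope ring_scope.

(* Bilinear pairing x^T A y, read off as the unique entry of a 1 x 1 matrix. *)
Definition bilin (R : realType) (n : nat) (A : 'M[R]_n) (x y : 'cV[R]_n) : R :=
  (x^T *m A *m y) 0 0.

Definition dotc (R : realType) (n : nat) (x y : 'cV[R]_n) : R :=
  (x^T *m y) 0 0.

(* Definiteness is understood for symmetric matrices. *)
Definition posdefmx (R : realType) (n : nat) (A : 'M[R]_n) : Prop :=
  A^T = A /\ forall x : 'cV[R]_n, x != 0 -> 0 < bilin A x x.

Definition possemidefmx (R : realType) (n : nat) (A : 'M[R]_n) : Prop :=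
  A^T = A /\ forall x : 'cV[R]_n, 0 <= bilin A x x.

Definition negdefmx (R : realType) (n : nat) (A : 'M[R]_n) : Prop :=
  A^T = A /\ forall x : 'cV[R]_n, x != 0 -> bilin A x x < 0.

Definition hfun (R : realType) (n : nat) (H : 'M[R]_n) (b x : 'cV[R]_n) : R :=
  2^-1 * bilin H x x - dotc b x.

Definition Gmx (R : realType) (m n : nat) (B : 'M[R]_(m, n)) (Q H : 'M[R]_n)
    (mu vs sg : R) : 'M[R]_n :=
  Q + (mu * vs) *: (B^T *m B) - sg *: H.

(* In the following, a pair z stands for (varsigma, sigma). *)

Definition Splus (R : realType) (m n : nat) (B : 'M[R]_(m, n)) (Q H : 'M[R]_n)
    (lambda mu : R) : set (R * R) :=
  [set z | [/\ - lambda <= z.1, 0 <= z.2 & posdefmx (Gmx B Q H mu z.1 z.2)]].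

Definition bdSplus (R : realType) (m n : nat) (B : 'M[R]_(m, n))
    (Q H : 'M[R]_n) (lambda mu : R) : set (R * R) :=
  [set z | [/\ - lambda <= z.1, 0 <= z.2,
               possemidefmx (Gmx B Q H mu z.1 z.2)
             & \det (Gmx B Q H mu z.1 z.2) = 0]].

Definition Pdual (R : realType) (m n : nat) (B : 'M[R]_(m, n)) (Q H : 'M[R]_n)
    (lambda : R) (f b : 'cV[R]_n) (mu : R) (z : R * R) : R :=
  let: (vs, sg) := z in
  - (2^-1 * bilin (invmx (Gmx B Q H mu vs sg)) (f - sg *: b) (f - sg *: b))
  - mu * lambda * vs - mu / 2 * vs ^+ 2 + sg / mu.

(* The filter "z tends to infinity" for regions bounded below in both
   coordinates, such as Splus: its basic sets contain every z having at least
   one (not necessarily each) coordinate beyond a threshold K. On Splus this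
   coincides with the norm of z tending to +oo. A limit as sigma -> -oo would
   be vacuous there, since 0 <= sigma. *)
Definition infty_nbhs2 (R : realType) : set_system (R * R) :=
  [set A | exists K : R, forall z : R * R, K <= z.1 \/ K <= z.2 -> A z].

(* Main.v *)
Require Import Defs.
From HB Require Import structures.
From mathcomp Require Import all_boot all_order all_algebra.
From mathcomp Require Import all_classical all_reals all_analysis.
From mathcomp Require Import ring lra.
Import Order.TTheory GRing.Theory Num.Theory.
Import numFieldNormedType.Exports.
Local Open Scope classical_set_scope.
Local Open Scope ring_scope.

(* The superlevel sets of [Pdual] on [Splus] generate a proper filter which, by
   [lim_infty], contains a compact rectangle intersected with the closed set
   where [Gmx] is positive semidefinite; hence it has a cluster point there. By
   [lim_boundary] this point is not on [bdSplus], so it lies in [Splus], and it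
   is a maximizer because [Pdual] is upper semicontinuous on [Splus]: since
   [- 1/2 v^T G^-1 v] is the minimum over [y] of [1/2 y^T G y - v^T y], [Pdual]
   is an infimum of polynomials in [(varsigma, sigma)]. [Splus] is nonempty
   because [- H] is positive definite and sigma may be taken large. *)

(** * Symmetric bilinear forms and definiteness *)

Section Bilinear.
Context {R : realType} {n : nat}.
Implicit Types (A C : 'M[R]_n) (x y z : 'cV[R]_n) (a : R).

Lemma bilin_dotc A x y : bilin A x y = dotc x (A *m y).
Proof. by rewrite /bilin /dotc mulmxA. Qed.

Lemma dotcC x y : dotc x y = dotc y x.
Proof. by rewrite /dotc -[in LHS](trmxK y) -trmx_mul mxE. Qed.

Lemma dotcDr x y z : dotc x (y + z) = dotc x y + dotc x z.
Proof. by rewrite /dotc mulmxDr mxE. Qed.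

Lemma dotcZr a x y : dotc x (a *: y) = a * dotc x y.
Proof. by rewrite /dotc -scalemxAr mxE. Qed.

Lemma dotcDl x y z : dotc (x + y) z = dotc x z + dotc y z.
Proof. by rewrite dotcC dotcDr !(dotcC z). Qed.

Lemma dotcZl a x y : dotc (a *: x) y = a * dotc x y.
Proof. by rewrite dotcC dotcZr dotcC. Qed.

Lemma dotc_eq0 x : (dotc x x == 0) = (x == 0).
Proof.
apply/idP/eqP => [|->]; last by rewrite /dotc mulmx0 mxE.
rewrite /dotc mxE psumr_eq0 => [|i _]; last by rewrite mxE -expr2 sqr_ge0.
move=> /allP x0; apply/colP => i; rewrite mxE.
by have := x0 i (mem_index_enum _); rewrite mxE mulf_eq0 orbb => /eqP.
Qed.

Lemma dotc_mulmxr A x y : dotc x (A *m y) = dotc (A^T *m x) y.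
Proof. by rewrite /dotc trmx_mul trmxK mulmxA. Qed.

Lemma bilinC A x y : A^T = A -> bilin A x y = bilin A y x.
Proof. by move=> As; rewrite !bilin_dotc dotc_mulmxr As dotcC. Qed.

Lemma bilinDmx A C x y : bilin (A + C) x y = bilin A x y + bilin C x y.
Proof. by rewrite !bilin_dotc mulmxDl dotcDr. Qed.

Lemma bilinZmx a A x y : bilin (a *: A) x y = a * bilin A x y.
Proof. by rewrite !bilin_dotc -scalemxAl dotcZr. Qed.

Lemma bilin_line A x y a : A^T = A ->
  bilin A (x + a *: y) (x + a *: y) =
  bilin A x x + 2 * a * bilin A x y + a ^+ 2 * bilin A y y.
Proof.
move=> As; have := bilinC A x y As; rewrite !bilin_dotc => xy.
rewrite mulmxDr -scalemxAr !(dotcDl, dotcDr) !(dotcZl, dotcZr) -xy; ring.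
Qed.

Lemma bilinE A x y : bilin A x y = \sum_i \sum_j A i j * (x i 0 * y j 0).
Proof.
rewrite bilin_dotc /dotc mxE; apply: eq_bigr => i _.
rewrite !mxE big_distrr /=; apply: eq_bigr => j _; ring.
Qed.

Lemma posdefmxW A : posdefmx A -> possemidefmx A.
Proof.
move=> [As Apos]; split=> // x; have [->|x0] := eqVneq x 0; last exact/ltW/Apos.
by rewrite bilin_dotc mulmx0 /dotc mulmx0 mxE.
Qed.

Lemma bilin_cauchy_schwarz A x y : possemidefmx A ->
  bilin A x y ^+ 2 <= bilin A x x * bilin A y y.
Proof.
move=> [As Apos].
have ax := Apos x; have ay := Apos y.
have [y0|y0] := eqVneq (bilin A y y) 0.
  have [-> |xy0] := eqVneq (bilin A x y) 0; first by rewrite y0 mulr0 expr0n.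
  (* With [bilin A y y = 0] the form is affine along the line through [x] in direction [y]; at this
     parameter it would equal -1. *)
  have := Apos (x + (- (bilin A x x + 1) / (2 * bilin A x y)) *: y).
  rewrite bilin_line// y0 mulr0 addr0.
  have -> : 2 * (- (bilin A x x + 1) / (2 * bilin A x y)) * bilin A x y
    = - (bilin A x x + 1) by field.
  lra.
(* This parameter minimizes the quadratic along the line. *)
have := Apos (x + (- bilin A x y / bilin A y y) *: y).
rewrite bilin_line//.
have -> : bilin A x x + 2 * (- bilin A x y / bilin A y y) * bilin A x y +
    (- bilin A x y / bilin A y y) ^+ 2 * bilin A y y
  = (bilin A x x * bilin A y y - bilin A x y ^+ 2) / bilin A y y by field.
by rewrite pmulr_lge0 ?subr_ge0// invr_gt0 lt_def y0.
Qed.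

(** Cauchy-Schwarz against the vector [A *m x], for which the mixed term is the squared Euclidean
    norm of [A *m x]. *)
Lemma possemidef_ker A x : possemidefmx A -> bilin A x x = 0 -> A *m x = 0.
Proof.
move=> Apos x0; have := bilin_cauchy_schwarz _ (A *m x) x Apos.
rewrite x0 mulr0 bilin_dotc => le0; apply/eqP; rewrite -dotc_eq0 -sqrf_eq0.
by rewrite eq_le le0 sqr_ge0.
Qed.

Lemma possemidef_posdef A : possemidefmx A -> A \in unitmx -> posdefmx A.
Proof.
move=> Apos Au; split=> [|x x0]; first by case: Apos.
rewrite lt_def (proj2 Apos) andbT; apply: contraNneq x0 => /possemidef_ker Ax0.
by rewrite -(mulKmx Au x) Ax0// mulmx0.
Qed.

Lemma posdef_unitmx A : posdefmx A -> A \in unitmx.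
Proof.
move=> [As Apos]; rewrite unitmxE unitfE; apply/negP => /det0P [v v0 vA].
have vT0 : v^T != 0 by rewrite -(inj_eq trmx_inj) trmxK trmx0.
by have := Apos _ vT0; rewrite /bilin trmxK vA mul0mx mxE ltxx.
Qed.

(** Cauchy-Schwarz for [A] between [x] and [invmx A *m e], with [e] the i-th basis vector: pairing
    them through [A] returns the coordinate [x i 0]. *)
Lemma coord_posdef_bound A x i : posdefmx A ->
  x i 0 ^+ 2 <= invmx A i i * bilin A x x.
Proof.
move=> Apos; have Au := posdef_unitmx _ Apos; have [As _] := Apos.
pose e : 'cV[R]_n := delta_mx i 0.
have eE y : dotc e y = y i 0 by rewrite /dotc trmx_delta -rowE mxE.
have := bilin_cauchy_schwarz _ x (invmx A *m e) (posdefmxW _ Apos).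
rewrite !(bilin_dotc A _ (invmx A *m e)) mulKVmx// !(dotcC _ e) !eE.
by rewrite -colE mxE mulrC.
Qed.

(** An explicit [c] avoids compactness of the unit sphere: it is the sum of the [|C i j|] times the
    trace of [invmx A], which controls every squared coordinate. *)
Lemma bilin_posdef_bound A C : posdefmx A ->
  exists2 c, 0 <= c & forall x, `|bilin C x x| <= c * bilin A x x.
Proof.
move=> Apos; pose d := \sum_i invmx A i i; have Anneg := posdefmxW _ Apos.
have dd i : 0 <= invmx A i i.
  have [Ai0|//] := ltP (invmx A i i) 0.
  have := coord_posdef_bound _ (delta_mx i 0) i Apos.
  rewrite mxE !eqxx expr1n; have := proj2 Anneg (delta_mx i 0); nra.
have dle i : invmx A i i <= d.
  by rewrite /d (bigD1 i)//= lerDl sumr_ge0.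
exists ((\sum_i \sum_j `|C i j|) * d) => [|x].
  by rewrite mulr_ge0 ?sumr_ge0// => i _; exact: sumr_ge0.
have xle i : x i 0 ^+ 2 <= d * bilin A x x.
  apply: le_trans (coord_posdef_bound _ x i Apos) _.
  by rewrite ler_wpM2r// (proj2 Anneg).
rewrite bilinE -mulrA big_distrl/=; apply: le_trans (ler_norm_sum _ _ _) _.
apply: ler_sum => i _; rewrite big_distrl/=.
apply: le_trans (ler_norm_sum _ _ _) _; apply: ler_sum => j _.
rewrite normrM ler_wpM2l// ler_norml.
(* Uses |st| <= (s^2 + t^2) / 2 for the two coordinates. *)
have := xle i; have := xle j.
have := sqr_ge0 (x i 0 + x j 0); have := sqr_ge0 (x i 0 - x j 0).
rewrite !expr2 => *; apply/andP; split; lra.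
Qed.

(** Completing the square: the two sides differ by half the form of [A] at [y - invmx A *m x]. *)
Lemma bilin_invmx_min A x y : posdefmx A ->
  - (2^-1 * bilin (invmx A) x x) <= 2^-1 * bilin A y y - dotc x y.
Proof.
move=> Apos; have Au := posdef_unitmx _ Apos; have [As _] := Apos.
have := proj2 (posdefmxW _ Apos) (y + (-1) *: (invmx A *m x)).
rewrite bilin_line// !(bilin_dotc A _ (invmx A *m x)) mulKVmx// bilin_dotc.
rewrite (dotcC y x) (dotcC (invmx A *m x)) (bilin_dotc _ x x); lra.
Qed.

Lemma bilin_invmx_eq A x (y := invmx A *m x) : A \in unitmx ->
  2^-1 * bilin A y y - dotc x y = - (2^-1 * bilin (invmx A) x x).
Proof.
move=> Au; rewrite /y bilin_dotc mulKVmx// bilin_dotc (dotcC _ x).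
by field.
Qed.

End Bilinear.

(** * The dual objective and its feasible region *)

Section Dual.
Context {R : realType} {m n : nat} (B : 'M[R]_(m, n)) (Q H : 'M[R]_n).
Context (lambda : R) (f b : 'cV[R]_n) (mu : R).
Hypotheses (Qsym : Q^T = Q) (Hneg : negdefmx H).

Let G (z : R * R) := Gmx B Q H mu z.1 z.2.
Let S := Splus B Q H lambda mu.
Let P := Pdual B Q H lambda f b mu.

Lemma Gmx_sym vs sg : (Gmx B Q H mu vs sg)^T = Gmx B Q H mu vs sg.
Proof.
case: Hneg => Hs _; rewrite /Gmx -scaleNr !raddfD/= !linearZ/=.
by rewrite trmx_mul trmxK Qsym Hs.
Qed.

Lemma bilin_Gmx vs sg x y : bilin (Gmx B Q H mu vs sg) x y =
  bilin Q x y + mu * vs * bilin (B^T *m B) x y - sg * bilin H x y.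
Proof. by rewrite /Gmx -scaleNr !bilinDmx !bilinZmx mulNr. Qed.

Lemma Splus_nonempty : 0 < lambda -> S !=set0.
Proof.
move=> l0; have NHpos : posdefmx (- H).
  case: Hneg => Hs Hx; split=> [|x x0]; first by rewrite raddfN /= Hs.
  by rewrite -scaleN1r bilinZmx mulN1r oppr_gt0 Hx.
have [c c0 cP] := bilin_posdef_bound _ Q NHpos.
(* Varsigma 0 removes the [B] term; since [c] times the form of [- H] dominates that of [Q], sigma
   [c + 1] leaves at least one full copy of [- H]. *)
exists (0, c + 1); split => /=; rewrite ?oppr_le0 ?(ltW l0) ?addr_ge0//.
split=> [|x x0]; first exact: Gmx_sym.
have := cP x; have := proj2 NHpos x x0.
rewrite bilin_Gmx -scaleN1r bilinZmx ler_norml => ? /andP[]; nra.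
Qed.

Lemma continuous_bilin_Gmx x y : continuous (fun z => bilin (G z) x y).
Proof.
rewrite /G; under eq_fun do rewrite bilin_Gmx.
move=> z; apply: cvgB; first apply: cvgD; first exact: cvg_cst.
  by apply: cvgMr_tmp; apply: cvgMl_tmp; exact: cvg_fst.
by apply: cvgMr_tmp; exact: cvg_snd.
Qed.

(** Symmetry of [Gmx] is automatic, so only the inequalities at each fixed [x] remain, and each is
    closed in [z]. *)
Lemma closed_possemidef_Gmx : closed [set z | possemidefmx (G z)].
Proof.
rewrite (_ : [set z | _] =
  \bigcap_(x in setT) [set z | 0 <= bilin (G z) x x]).
  apply: closed_bigI => x _.
  apply: (@preimage_closed _ _ (fun z => bilin (G z) x x) [set y | 0 <= y])
    => [z _|].
    exact: continuous_bilin_Gmx.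
  exact: (@closed_ge R 0).
apply/seteqP; split=> z /= Gz; first by move=> x _; exact: (proj2 Gz).
by split; [exact: Gmx_sym|move=> x; exact: Gz].
Qed.

(** The function of [y] and [z] whose minimum over [y] is [Pdual] on [Splus]; it contains no
    inverse, hence is continuous in [z] everywhere. *)
Definition Pbound y z :=
  2^-1 * bilin (G z) y y - dotc (f - z.2 *: b) y
  - mu * lambda * z.1 - mu / 2 * z.1 ^+ 2 + z.2 / mu.

Lemma Pdual_le_Pbound y z : S z -> P z <= Pbound y z.
Proof.
case: z => vs sg [_ _ Gpos]; rewrite /P /Pbound /= 3!lerD2r.
exact: bilin_invmx_min.
Qed.

Lemma Pdual_eq_Pbound z : S z ->
  P z = Pbound (invmx (G z) *m (f - z.2 *: b)) z.
Proof.
case: z => vs sg [_ _ /posdef_unitmx Gu].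
by rewrite /P /Pbound bilin_invmx_eq.
Qed.

Lemma continuous_Pbound y : continuous (Pbound y).
Proof.
rewrite /Pbound => z.
apply: cvgD; last by apply: cvgMr_tmp; exact: cvg_snd.
apply: cvgB; last first.
  under eq_fun do rewrite expr2.
  by rewrite expr2; apply: cvgMl_tmp; apply: cvgM; exact: cvg_fst.
apply: cvgB; last by apply: cvgMl_tmp; exact: cvg_fst.
apply: cvgB; first by apply: cvgMl_tmp; exact: continuous_bilin_Gmx.
under eq_fun do rewrite -scaleNr dotcDl dotcZl.
rewrite -scaleNr dotcDl dotcZl; apply: cvgD; first exact: cvg_cst.
by apply: cvgMr_tmp; apply: cvgN; exact: cvg_snd.
Qed.

(** Freezing [y] at the minimizer for [z] gives a continuous majorant of [P] on [S] that touches it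
    at [z]. *)
Lemma Pdual_upper_semicontinuous z a : S z -> P z < a ->
  \forall z' \near z, S z' -> P z' < a.
Proof.
move=> Sz; rewrite Pdual_eq_Pbound//.
set y := invmx _ *m _ => lt_a.
have : \forall z' \near z, Pbound y z' < a.
  by apply: (continuous_Pbound y z [set t | t < a]); exact: lt_nbhsl.
apply: filterS => z' lt_a' Sz'; apply: le_lt_trans lt_a'.
exact: Pdual_le_Pbound.
Qed.

End Dual.

(** * Existence of a maximizer *)

Theorem theorem3 (R : realType) (m n : nat)
    (B : 'M[R]_(m, n)) (Q H : 'M[R]_n) (lambda : R) (f b : 'cV[R]_n)
    (mu0 delta : R)
    (Qsym : Q^T = Q) (Hneg : negdefmx H) (lambda_gt0 : 0 < lambda)
    (h_gt0 : 0 < hfun H b (invmx H *m b))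
    (mu0E : mu0^-1 = hfun H b (invmx H *m b))
    (delta_gt0 : 0 < delta) (delta_le : delta <= mu0^-1)
    (mu : R) (mu_ge : mu0 <= mu) (mu_le : mu <= delta^-1)
    (lim_boundary : forall z0 : R * R, bdSplus B Q H lambda mu z0 ->
       Pdual B Q H lambda f b mu z @[z --> within (Splus B Q H lambda mu) (nbhs z0)]
         --> -oo)
    (lim_infty :
       Pdual B Q H lambda f b mu z
         @[z --> within (Splus B Q H lambda mu) (@infty_nbhs2 R)] --> -oo) :
  exists z : R * R, Splus B Q H lambda mu z /\
    forall z' : R * R, Splus B Q H lambda mu z' ->
      Pdual B Q H lambda f b mu z' <= Pdual B Q H lambda f b mu z.
Proof.
set S := Splus B Q H lambda mu; set P := Pdual B Q H lambda f b mu.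
have [z1 Sz1] : S !=set0 by exact: Splus_nonempty.
pose U w := [set z | S z /\ P w <= P z].
pose F : set_system (R * R) := filter_from S U.
have FF : ProperFilter F.
  apply: filter_from_proper => [|w Sw]; last by exists w; split.
  apply: filter_from_filter; first by exists z1.
  (* Superlevel sets are nested, so the one at the larger value lies in both. *)
  move=> w w' Sw Sw'; have [ww'|/ltW w'w] := leP (P w) (P w').
    by exists w' => // z [Sz le]; do 2 split=> //; exact: le_trans le.
  by exists w => // z [Sz le]; do 2 split=> //; exact: le_trans le.
have [K Klt] : exists K, forall z, S z -> K <= z.1 \/ K <= z.2 -> P z < P z1.
  have [|K KP] := lim_infty [set y | y < P z1].
    by exists (P z1); rewrite num_real; split.
  by exists K => z Sz zK; exact: KP.
(* Semidefiniteness replaces definiteness here to obtain a closed condition. *)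
have Kcpt := compact_closedI
  (compact_setX (@segment_compact R (- lambda) K) (@segment_compact R 0 K))
  (closed_possemidef_Gmx B Q H mu Qsym Hneg).
have [|z [[[z1K z2K] Gz] Fz]] := Kcpt F FF.
  (* The superlevel set of [z1] lies in the compact set: a coordinate beyond [K] would force the
     value below [P z1]. *)
  exists z1 => // z [Sz lez]; have [l1 l2 Gpos] := Sz.
  have Kz : ~ (K <= z.1 \/ K <= z.2) by move=> /(Klt _ Sz); rewrite ltNge lez.
  split; last exact: posdefmxW.
  by split; rewrite /= in_itv /= ?l1 ?l2 /= leNgt;
    apply/negP => /ltW ?; apply: Kz; [left|right].
have {z1K z2K} [/andP[l1 _] /andP[l2 _]] :
    (- lambda <= z.1 <= K) /\ (0 <= z.2 <= K).
  by move: z1K z2K; rewrite /= !in_itv.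
(* Every neighbourhood of the cluster point [z] meets every superlevel set [U w], so [P] cannot stay
   below [P w] on [S] near [z]. *)
have Uclust w : S w -> (\forall z' \near z, S z' -> P z' < P w) -> False.
  move=> Sw zw; have [|z' [[Sz' lez'] /(_ Sz')]] := Fz (U w) _ _ zw.
    by exists w.
  by rewrite ltNge lez'.
have Sz : S z.
  split=> //; apply: possemidef_posdef => //; rewrite unitmxE unitfE.
  (* A zero determinant would put [z] in [bdSplus], where divergence to [-oo] keeps nearby values
     below [P z1]. *)
  apply/negP => /eqP dz; apply: (Uclust z1 Sz1).
  have bdz : bdSplus B Q H lambda mu z by split.
  have := lim_boundary z bdz [set y | y < P z1]; apply.
  by exists (P z1); rewrite num_real; split.
exists z; split=> // w Sw; rewrite leNgt; apply/negP => lt_w.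
exact/(Uclust w Sw)/Pdual_upper_semicontinuous.
Qed.
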